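(* Let $u_0(r,t)=e^{it}$ and, for $n\ge 0$, define $$u_{n+1}(r,t)=u_n(r,t)+\int_{0}^{r}\lambda(r,s)\left(\frac{\partial^2 u_{n}}{\partial s^2}(s,t)-\frac{\partial^2 u_{n}}{\partial t^2}(s,t)+s\,u_{n}(s,t)\right)ds ,$$ where $\lambda(r,s)=\sum_{k=0}^{\infty}\alpha_k(r)(s-r)^k$ is the Lagrange multiplier. Then for every $R>0$ the sequence $(u_n)$ converges uniformly on $[-R,R]\times\mathbb{R}$ to $$u(r,t)=e^{it}\sum_{k=0}^{\infty}a_k r^k ,$$ the solution of the Klein-Gordon problem $u_{rr}-u_{tt}+ru=0$, $u(0,t)=e^{it}$, $u_r(0,t)=0$.
   Context: The Klein-Gordon problem is $$u_{rr}-u_{tt}+ru=0\quad (r>0,\ -\infty<t<\infty),\qquad u(0,t)=e^{it},\qquad u_r(0,t)=0,$$ and its unique solution is $u(r,t)=e^{it}\sum_{k=0}^\infty a_kr^k$, where the real numbers $a_k$ (the Airy coefficients) are defined by $a_0=1$, $a_1=0$, $a_2=-\tfrac12$ and $$a_k=-\frac{a_{k-3}+a_{k-2}}{k(k-1)},\qquad k\ge 3 .$$ The functions $\alpha_k=\alpha_k(r)$ (polynomials in $r$) are defined by $\alpha_0=0$, $\alpha_1=1$, $\alpha_2=0$ and $$\alpha_k=-\frac{\alpha_{k-3}+r\,\alpha_{k-2}}{k(k-1)},\qquad k\ge 3 .$$ *)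

(* Defs.v *)
From Stdlib Require Import Reals.
From Coquelicot Require Import Coquelicot.
Open Scope R_scope.

(* Complex-valued functions of real variables
   are differentiated and integrated in C seen as a real normed space. *)

(* Below, k3 stands for k - 3 and k2 = S k3 for k - 2. *)
Fixpoint airy_coef (k : nat) : R :=
  match k with
  | O => 1
  | S O => 0
  | S (S O) => - (1 / 2)
  | S (S (S k3 as k2)) =>
      - ((airy_coef k3 + airy_coef k2) / (INR k * (INR k - 1)))
  end.

Fixpoint alpha (k : nat) (r : R) : R :=
  match k with
  | O => 0
  | S O => 1
  | S (S O) => 0
  | S (S (S k3 as k2)) =>
      - ((alpha k3 r + r * alpha k2 r) / (INR k * (INR k - 1)))
  end.

Definition lagrange_mult (r s : R) : R :=
  Series (fun k => alpha k r * (s - r) ^ k).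

(* The complex number e^{it}. *)
Definition expi (t : R) : C := (cos t, sin t).

(* Second derivative of a complex-valued function of a real variable;
   Coquelicot's total derivative operators are real-valued only. *)
Definition CDerive2 (f : R -> C) (x : R) : C :=
  (Derive_n (fun y => Re (f y)) 2 x, Derive_n (fun y => Im (f y)) 2 x).

Fixpoint vim (n : nat) : R -> R -> C :=
  match n with
  | O => fun _ t => expi t
  | S m => fun r t =>
      (vim m r t +
       RInt (V := C_R_CompleteNormedModule)
         (fun s => RtoC (lagrange_mult r s) *
            (CDerive2 (fun x => vim m x t) s
             - CDerive2 (fun x => vim m s x) t
             + RtoC s * vim m s t)) 0 r)%C
  end.

Definition kg_series (r t : R) : C :=
  (expi t * RtoC (Series (fun k => airy_coef k * r ^ k)%R))%C.

Definition continuous_in (D : R * R -> Prop) (f : R -> R -> C) : Prop :=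
  forall r t, D (r, t) ->
    filterlim (fun p : R * R => f (fst p) (snd p) : C_R_NormedModule)
      (within D (locally ((r, t) : R * R)))
      (locally (f r t : C_R_NormedModule)).

(* C^1 on D with partial derivatives fr and ft.  The derivatives are taken
   within D, hence are one-sided at a boundary point of a half-plane. *)
Definition C1_in (D : R * R -> Prop) (f fr ft : R -> R -> C) : Prop :=
  (forall r t, D (r, t) ->
     filterdiff (fun x : R => f x t : C_R_NormedModule)
       (within (fun x => D (x, t)) (locally r))
       (fun h : R => scal h (fr r t : C_R_NormedModule))) /\
  (forall r t, D (r, t) ->
     filterdiff (fun x : R => f r x : C_R_NormedModule)
       (within (fun x => D (r, x)) (locally t))
       (fun h : R => scal h (ft r t : C_R_NormedModule))) /\
  continuous_in D f /\ continuous_in D fr /\ continuous_in D ft.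

(* Classical solutions: C^2 for r > 0, and C^1 up to the boundary r = 0.
   Values at r < 0 are unconstrained. *)
Definition kg_solution (u : R -> R -> C) : Prop :=
  exists ur ut urr urt utr utt : R -> R -> C,
    C1_in (fun p => 0 <= fst p) u ur ut /\
    C1_in (fun p => 0 < fst p) ur urr urt /\
    C1_in (fun p => 0 < fst p) ut utr utt /\
    (forall r t, 0 < r -> (urr r t - utt r t + RtoC r * u r t)%C = 0%C) /\
    (forall t, u 0 t = expi t) /\
    (forall t, ur 0 t = 0%C).

(* Main.v *)
(** The iterates are [e^{it} f_n(r)] with [f_n] an entire power series.  For fixed
    [r], [s |-> lambda(r,s)] solves [y'' + s y = 0] with [y(r) = 0], [y'(r) = 1], so
    two integrations by parts turn the correction step into
    [f_{n+1}'' + r f_{n+1} = - f_n], [f_{n+1}(0) = 1], [f_{n+1}'(0) = 0].  Hence the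
    coefficients of [f_n] agree with the Airy coefficients up to degree [2n+1] and
    are dominated by one entire majorant, which gives locally uniform convergence.

    Uniqueness: for a solution [w] with zero data, the derivative of [w_r + s w_t]
    ([s = 1] or [-1]) along a characteristic is [- r w].  Integrating this and then
    [w_r], a bound [|w| <= A r^n] on a backward triangle [|t - t0| <= r0 - r]
    improves to [|w| <= A r0 r^(n+2) / ((n+1)(n+2))]; iterating forces [w = 0]. *)

Require Import Defs.
From Stdlib Require Import Reals Arith Lra Lia FunctionalExtensionality.
From Coquelicot Require Import Coquelicot.
Open Scope R_scope.

(** * Entire power series and Airy-type recurrences *)

Definition entire (c : nat -> R) : Prop := CV_radius c = p_infty.

Lemma entire_lt (c : nat -> R) (x : R) : entire c -> Rbar_lt (Rabs x) (CV_radius c).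
Proof. intros H; rewrite H; exact I. Qed.

Lemma entire_derive (c : nat -> R) : entire c -> entire (PS_derive c).
Proof. unfold entire; intros H; now rewrite CV_radius_derive. Qed.

Lemma entire_is_derive (c : nat -> R) (x : R) :
  entire c -> is_derive (PSeries c) x (PSeries (PS_derive c) x).
Proof. intros H; apply is_derive_PSeries, entire_lt, H. Qed.

Lemma entire_continuous (c : nat -> R) (x : R) : entire c -> continuous (PSeries c) x.
Proof.
  intros H; apply (ex_derive_continuous (V := R_NormedModule)).
  eexists; apply entire_is_derive, H.
Qed.

Lemma entire_ex_series (c : nat -> R) (x : R) :
  entire c -> ex_series (fun k => Rabs (c k * x ^ k)).
Proof. intros H; apply CV_disk_inside, entire_lt, H. Qed.

Lemma entire_ex_pseries (c : nat -> R) (x : R) : entire c -> ex_pseries c x.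
Proof. intros H; apply CV_radius_inside, entire_lt, H. Qed.

(** The radius of convergence is an upper bound for every [x] at which the terms [c k * x ^ k] stay
    bounded; here every positive [x] is such a point. *)
Lemma entire_of_bounded (c : nat -> R) :
  (forall x, 0 < x -> exists M, forall k, Rabs (c k * x ^ k) <= M) -> entire c.
Proof.
  intros H. unfold entire.
  destruct (CV_radius_bounded c) as [Hub _].
  assert (Hx : forall x, 0 < x -> Rbar_le x (CV_radius c))
    by (intros x Hx; apply Hub, H, Hx).
  destruct (CV_radius c) as [l| |]; [exfalso| reflexivity | exfalso].
  (* A finite radius [l] is refuted at [Rabs l + 1], which is positive and exceeds [l] whatever the
     sign of [l]. *)
  - specialize (Hx (Rabs l + 1)); simpl in Hx.
    pose proof (Rabs_pos l); pose proof (Rle_abs l).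
    assert (Rabs l + 1 <= l) by (apply Hx; lra). lra.
  - apply (Hx 1 Rlt_0_1).
Qed.

Lemma entire_dominated (c d : nat -> R) :
  (forall k, Rabs (c k) <= d k) -> entire d -> entire c.
Proof.
  intros Hcd Hd. apply entire_of_bounded. intros x Hx.
  destruct (filterlim_bounded (K := R_AbsRing) (V := R_NormedModule) (fun k => d k * x ^ k)) as [M HM].
  { exists 0. apply (ex_series_lim_0 (fun k => d k * x ^ k)).
    now apply ex_series_Rabs, entire_ex_series. }
  exists M. intros k. eapply Rle_trans; [|apply (HM k)].
  change (Rabs (c k * x ^ k) <= Rabs (d k * x ^ k)).
  rewrite !Rabs_mult. apply Rmult_le_compat_r; [apply Rabs_pos|].
  eapply Rle_trans; [apply Hcd | apply Rle_abs].
Qed.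

Lemma finite_prefix_bounded (c : nat -> R) (n : nat) :
  exists M, 0 <= M /\ forall k, (k < n)%nat -> Rabs (c k) <= M.
Proof.
  induction n as [|n [M [HM IH]]]; [exists 0; split; [lra | lia]|].
  exists (Rmax M (Rabs (c n))). split; [eapply Rle_trans; [apply HM | apply Rmax_l]|].
  intros k Hk. destruct (Nat.eq_dec k n) as [->|]; [apply Rmax_r|].
  eapply Rle_trans; [apply IH; lia | apply Rmax_l].
Qed.

(** For fixed [x], as soon as [(j+3)(j+2) >= p x^3 + q x^2] the recurrence cannot push
    [|c (j+3) x^(j+3)|] above a common bound of the terms of index [j] and [j+1]. A bound of a long
    enough initial segment therefore bounds all terms. *)
Lemma entire_of_recurrence (c : nat -> R) (p q : R) :
  0 <= p -> 0 <= q ->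
  (forall k, INR (k + 3) * INR (k + 2) * Rabs (c (k + 3)%nat)
             <= p * Rabs (c k) + q * Rabs (c (k + 1)%nat)) ->
  entire c.
Proof.
  intros Hp Hq Hc. apply entire_of_bounded. intros x Hx.
  set (A := p * x ^ 3 + q * x ^ 2).
  assert (Hx2 : 0 < x ^ 2) by now apply pow_lt.
  assert (Hx3 : 0 < x ^ 3) by now apply pow_lt.
  destruct (INR_unbounded A) as [K HK].
  destruct (finite_prefix_bounded (fun k => c k * x ^ k) (K + 3)) as [M [HM Hpre]].
  exists M. intros k; induction k as [k IH] using (well_founded_induction lt_wf).
  destruct (lt_dec k (K + 3)) as [Hk|Hk]; [now apply Hpre|].
  destruct (Nat.le_exists_sub 3 k) as [j [-> _]]; [lia|].
  assert (Hj : INR K <= INR j) by (apply le_INR; lia).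
  pose proof (pos_INR j) as Hj0.
  pose proof (IH j ltac:(lia)) as H0. pose proof (IH (j + 1)%nat ltac:(lia)) as H1.
  specialize (Hc j).
  assert (Hxj : 0 < x ^ j) by now apply pow_lt.
  rewrite !Rabs_mult in *.
  rewrite !pow_add in *. rewrite !Rabs_mult in H1 |- *. rewrite pow_1 in H1.
  rewrite !plus_INR in Hc. simpl (INR 3) in Hc; simpl (INR 2) in Hc.
  rewrite (Rabs_pos_eq (x ^ j)) in * by lra.
  rewrite (Rabs_pos_eq x) in H1 by lra.
  rewrite (Rabs_pos_eq (x ^ 3)) by lra.
  set (c0 := Rabs (c j)) in *. set (c1 := Rabs (c (j + 1)%nat)) in *.
  set (c3 := Rabs (c (j + 3)%nat)) in *. set (y := x ^ j) in *.
  set (D := (INR j + (1 + 1 + 1)) * (INR j + (1 + 1))) in *.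
  assert (Hjj : 0 <= INR j * INR j) by now apply Rmult_le_pos.
  (* [D = (j+3)(j+2)] is at least [j], and [j >= K > A]. *)
  assert (HD : A <= D) by (unfold D; lra).
  assert (HD0 : 0 < D) by (unfold D; lra).
  apply (Rmult_le_reg_l D); [exact HD0|].
  apply Rle_trans with (A * M); [|now apply Rmult_le_compat_r].
  replace (D * (c3 * (y * x ^ 3))) with (D * c3 * (y * x ^ 3)) by ring.
  apply Rle_trans with ((p * c0 + q * c1) * (y * x ^ 3)).
  { apply Rmult_le_compat_r; [left; now apply Rmult_lt_0_compat | exact Hc]. }
  replace ((p * c0 + q * c1) * (y * x ^ 3))
    with (p * x ^ 3 * (c0 * y) + q * x ^ 2 * (c1 * (y * x))) by ring.
  unfold A. rewrite Rmult_plus_distr_r.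
  apply Rplus_le_compat; (apply Rmult_le_compat_l; [apply Rmult_le_pos; lra | assumption]).
Qed.

(* The coefficient form of [y'' + (p + x) y + g = 0]. *)
Definition airy_rec (p : R) (d c : nat -> R) : Prop :=
  2 * c 2%nat + p * c 0%nat + d 0%nat = 0 /\
  forall k, INR (k + 3) * INR (k + 2) * c (k + 3)%nat
            + p * c (k + 1)%nat + c k + d (k + 1)%nat = 0.

(** The left side is a single power series whose coefficients vanish: the first clause of [airy_rec]
    is its constant term, the second its coefficient of degree [k + 1]. *)
Lemma airy_rec_ode (p : R) (d c : nat -> R) (x : R) :
  airy_rec p d c -> entire c -> entire d ->
  PSeries (PS_derive (PS_derive c)) x + (p + x) * PSeries c x + PSeries d x = 0.
Proof.
  intros [H2 H3] Hc Hd.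
  assert (E0 : ex_pseries c x) by now apply entire_ex_pseries.
  assert (E1 : ex_pseries d x) by now apply entire_ex_pseries.
  assert (E2 : ex_pseries (PS_derive (PS_derive c)) x)
    by now apply entire_ex_pseries, entire_derive, entire_derive.
  assert (E3 : ex_pseries (PS_scal p c) x) by (apply ex_pseries_scal; [apply Rmult_comm | exact E0]).
  assert (E4 : ex_pseries (PS_incr_1 c) x) by (apply ex_pseries_incr_1, E0).
  rewrite Rmult_plus_distr_r, <- PSeries_scal, <- PSeries_incr_1.
  pose proof (ex_pseries_plus _ _ _ E3 E4) as E5.
  pose proof (ex_pseries_plus _ _ _ E2 E5) as E6.
  rewrite <- (PSeries_plus _ _ _ E3 E4), <- (PSeries_plus _ _ _ E2 E5), <- (PSeries_plus _ _ _ E6 E1).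
  rewrite (PSeries_ext _ (fun _ => 0)); [apply PSeries_const_0|].
  intros [|k]; unfold PS_plus, PS_scal, PS_derive, PS_incr_1, plus, scal, zero; simpl;
    unfold mult; simpl.
  - etransitivity; [|exact H2]; ring.
  - specialize (H3 k).
    etransitivity; [|exact H3]. rewrite !plus_INR.
    replace (k + 3)%nat with (S (S (S k))) by lia.
    replace (k + 1)%nat with (S k) by lia.
    change (match k with O => 1 | S _ => INR k + 1 end) with (INR (S k)).
    rewrite !S_INR. simpl. ring.
Qed.

Lemma airy_rec_entire (p : R) (c : nat -> R) : airy_rec p (fun _ => 0) c -> entire c.
Proof.
  intros [_ H]. apply (entire_of_recurrence c 1 (Rabs p)); [lra | apply Rabs_pos|].
  intros k. specialize (H k).
  rewrite <- (Rabs_pos_eq (INR (k + 3))), <- (Rabs_pos_eq (INR (k + 2))) by apply pos_INR.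
  rewrite <- !Rabs_mult.
  replace (INR (k + 3) * INR (k + 2) * c (k + 3)%nat)
    with (- (1 * c k + p * c (k + 1)%nat)) by lra.
  rewrite Rabs_Ropp, !Rmult_1_l. apply Rabs_triang.
Qed.

Lemma airy_step (k : nat) (z : R) :
  INR (k + 3) * INR (k + 2) * - (z / (INR (S (S (S k))) * (INR (S (S (S k))) - 1))) = - z.
Proof.
  replace (k + 3)%nat with (S (S (S k))) by lia.
  replace (k + 2)%nat with (S (S k)) by lia. rewrite !S_INR.
  pose proof (pos_INR k). field. lra.
Qed.

Lemma airy_coef_SSS (k : nat) :
  airy_coef (S (S (S k))) =
  - ((airy_coef k + airy_coef (S k)) / (INR (S (S (S k))) * (INR (S (S (S k))) - 1))).
Proof. reflexivity. Qed.

Lemma alpha_SSS (k : nat) (r : R) :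
  alpha (S (S (S k))) r =
  - ((alpha k r + r * alpha (S k) r) / (INR (S (S (S k))) * (INR (S (S (S k))) - 1))).
Proof. reflexivity. Qed.

(** For [u = e^{it} A(r)] the term [- u_tt] is [u], so the equation reads [A'' + (1 + r) A = 0];
    hence [p = 1]. *)
Lemma airy_coef_rec : airy_rec 1 (fun _ => 0) airy_coef.
Proof.
  split; [simpl; lra|]. intros k.
  replace (airy_coef (k + 3)) with (airy_coef (S (S (S k)))) by (f_equal; lia).
  rewrite airy_coef_SSS, airy_step. replace (k + 1)%nat with (S k) by lia. ring.
Qed.

(** In the shifted variable [x = s - r] the equation [y'' + s y = 0] becomes [y'' + (r + x) y = 0];
    hence [p = r]. *)
Lemma alpha_rec (r : R) : airy_rec r (fun _ => 0) (fun k => alpha k r).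
Proof.
  split; [simpl; lra|]. intros k.
  replace (alpha (k + 3) r) with (alpha (S (S (S k))) r) by (f_equal; lia).
  rewrite alpha_SSS, airy_step. replace (k + 1)%nat with (S k) by lia. ring.
Qed.

(** * Coefficients of the iterates and their common majorant *)

(** Power series solution of [y'' + x y + g = 0], [y(0) = 1], [y'(0) = 0], where [g] has the
    coefficients [d]. One correction step of the iteration applies this operator to the previous
    iterate. *)
Fixpoint airy_solve (d : nat -> R) (k : nat) : R :=
  match k with
  | O => 1
  | S O => 0
  | S (S O) => - (d O / 2)
  | S (S (S k3 as k2)) =>
      - ((airy_solve d k3 + d k2) / (INR k * (INR k - 1)))
  end.

Fixpoint vim_coef (n : nat) : nat -> R :=
  match n with
  | O => fun k => match k with O => 1 | S _ => 0 end
  | S m => airy_solve (vim_coef m)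
  end.

Lemma airy_solve_SSS (d : nat -> R) (k : nat) :
  airy_solve d (S (S (S k))) =
  - ((airy_solve d k + d (S k)) / (INR (S (S (S k))) * (INR (S (S (S k))) - 1))).
Proof. reflexivity. Qed.

Lemma airy_solve_rec (d : nat -> R) : airy_rec 0 d (airy_solve d).
Proof.
  split; [simpl; lra|]. intros k.
  replace (airy_solve d (k + 3)) with (airy_solve d (S (S (S k)))) by (f_equal; lia).
  rewrite airy_solve_SSS, airy_step. replace (k + 1)%nat with (S k) by lia. ring.
Qed.

(** The Airy recurrence with every minus sign removed. Triangle inequalities then bound the limit
    and all iterates by the same sequence. *)
Fixpoint airy_majorant (k : nat) : R :=
  match k with
  | O => 1
  | S O => 0
  | S (S O) => 1 / 2
  | S (S (S k3 as k2)) =>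
      (airy_majorant k3 + airy_majorant k2) / (INR k * (INR k - 1))
  end.

Lemma airy_majorant_SSS (k : nat) :
  airy_majorant (S (S (S k))) =
  (airy_majorant k + airy_majorant (S k)) / (INR (S (S (S k))) * (INR (S (S (S k))) - 1)).
Proof. reflexivity. Qed.

Lemma airy_denom_pos (k : nat) : 0 < INR (S (S (S k))) * (INR (S (S (S k))) - 1).
Proof. rewrite !S_INR. pose proof (pos_INR k). nra. Qed.

(** The induction step follows the shape of the recurrences, in which index [k + 3] depends on [k]
    and [k + 1]. *)
Lemma three_step_ind (P : nat -> Prop) :
  P 0%nat -> P 1%nat -> P 2%nat ->
  (forall k, P k -> P (S k) -> P (S (S (S k)))) -> forall k, P k.
Proof.
  intros H0 H1 H2 H k.
  enough (P k /\ P (S k) /\ P (S (S k))) by tauto.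
  induction k as [|k [IH0 [IH1 IH2]]]; auto.
Qed.

Lemma Rabs_airy_quotient (k : nat) (x y X Y : R) :
  Rabs x <= X -> Rabs y <= Y ->
  Rabs (- ((x + y) / (INR (S (S (S k))) * (INR (S (S (S k))) - 1)))) <=
  (X + Y) / (INR (S (S (S k))) * (INR (S (S (S k))) - 1)).
Proof.
  intros Hx Hy. pose proof (airy_denom_pos k) as HD.
  rewrite Rabs_Ropp. unfold Rdiv. rewrite Rabs_mult.
  rewrite (Rabs_pos_eq (/ _)) by (left; now apply Rinv_0_lt_compat).
  apply Rmult_le_compat_r; [left; now apply Rinv_0_lt_compat|].
  eapply Rle_trans; [apply Rabs_triang | lra].
Qed.

Lemma airy_majorant_entire : entire airy_majorant.
Proof.
  assert (H0 : forall k, 0 <= airy_majorant k).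
  { apply three_step_ind; try (simpl; lra). intros k Hk Hk1.
    rewrite airy_majorant_SSS. pose proof (airy_denom_pos k).
    apply Rdiv_le_0_compat; lra. }
  apply (entire_of_recurrence _ 1 1); try lra. intros k.
  replace (airy_majorant (k + 3)) with (airy_majorant (S (S (S k)))) by (f_equal; lia).
  rewrite !Rabs_pos_eq by apply H0.
  rewrite airy_majorant_SSS. pose proof (airy_step k (airy_majorant k + airy_majorant (S k))).
  replace (k + 1)%nat with (S k) by lia. lra.
Qed.

Lemma airy_coef_le_majorant (k : nat) : Rabs (airy_coef k) <= airy_majorant k.
Proof.
  revert k; apply three_step_ind; try (simpl; apply Rabs_le; lra).
  intros k Hk Hk1. now apply Rabs_airy_quotient.
Qed.

(** A double induction: coefficient [k + 3] of an iterate involves coefficient [k] of the same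
    iterate and coefficient [k + 1] of the previous one. *)
Lemma vim_coef_le_majorant (n k : nat) : Rabs (vim_coef n k) <= airy_majorant k.
Proof.
  revert k; induction n as [|n IH].
  - intros [|k]; [simpl; apply Rabs_le; lra|].
    simpl vim_coef. rewrite Rabs_R0.
    eapply Rle_trans; [apply Rabs_pos | apply airy_coef_le_majorant].
  - apply three_step_ind.
    + simpl; apply Rabs_le; lra.
    + simpl; apply Rabs_le; lra.
    + specialize (IH 0%nat). apply Rabs_le_between in IH. simpl in *. apply Rabs_le; lra.
    + intros k Hk Hk1. apply Rabs_airy_quotient; auto.
Qed.

(** Each iteration gains two correct degrees: coefficient [k + 3] of the new iterate needs only
    degree [k + 1] of the old one, a drop of two. *)
Lemma vim_coef_stable (n k : nat) : (k < 2 * n + 2)%nat -> vim_coef n k = airy_coef k.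
Proof.
  revert k; induction n as [|n IH].
  - intros [|[|k]] Hk; [reflexivity | reflexivity | lia].
  - intros k; revert k.
    apply (three_step_ind (fun k => (k < 2 * S n + 2)%nat -> vim_coef (S n) k = airy_coef k)).
    + reflexivity.
    + reflexivity.
    + intros _. simpl vim_coef. unfold airy_solve. rewrite IH by lia. simpl; lra.
    + intros k Hk _ Hlt.
      change (vim_coef (S n) (S (S (S k)))) with (airy_solve (vim_coef n) (S (S (S k)))).
      rewrite airy_solve_SSS, airy_coef_SSS. change (airy_solve (vim_coef n) k) with (vim_coef (S n) k).
      rewrite Hk, IH by lia. reflexivity.
Qed.

Lemma airy_coef_entire : entire airy_coef.
Proof. apply (airy_rec_entire 1), airy_coef_rec. Qed.

Lemma alpha_entire (r : R) : entire (fun k => alpha k r).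
Proof. apply (airy_rec_entire r), alpha_rec. Qed.

Lemma vim_coef_entire (n : nat) : entire (vim_coef n).
Proof. apply (entire_dominated _ airy_majorant), airy_majorant_entire; apply vim_coef_le_majorant. Qed.

(** * Tail estimates and uniform convergence of the radial factors *)

(** The terms up to degree [N] cancel, and each later difference is at most [2 * (m k * rho ^ k)], a
    bound independent of [x]. *)
Lemma PSeries_diff_tail (a b m : nat -> R) (N : nat) (x rho : R) :
  (forall k, Rabs (a k) <= m k) -> (forall k, Rabs (b k) <= m k) -> entire m ->
  (forall k, (k < S N)%nat -> a k = b k) -> Rabs x <= rho ->
  Rabs (PSeries a x - PSeries b x) <= 2 * Series (fun k => m (S N + k)%nat * rho ^ (S N + k)).
Proof.
  intros Ha Hb Hm Hab Hx.
  assert (Hrho : 0 <= rho) by (eapply Rle_trans; [apply Rabs_pos | exact Hx]).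
  assert (Hm0 : forall k, 0 <= m k) by (intros k; eapply Rle_trans; [apply Rabs_pos | apply Ha]).
  assert (Hea : entire a) by now apply entire_dominated with m.
  assert (Heb : entire b) by now apply entire_dominated with m.
  unfold PSeries. rewrite <- Series_minus by now apply ex_series_Rabs, entire_ex_series.
  assert (Hterm : forall k, Rabs (a k * x ^ k - b k * x ^ k) <= 2 * (m k * rho ^ k)).
  { intros k. rewrite <- Rmult_minus_distr_r, Rabs_mult, <- RPow_abs, <- Rmult_assoc.
    apply Rmult_le_compat; try apply Rabs_pos; [apply pow_le, Rabs_pos| |].
    - specialize (Ha k); specialize (Hb k). eapply Rle_trans; [apply Rabs_triang|].
      rewrite Rabs_Ropp. lra.
    - apply pow_incr; split; [apply Rabs_pos | exact Hx]. }
  assert (Hms : ex_series (fun k => 2 * (m k * rho ^ k))).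
  { apply (ex_series_scal_l (K := R_AbsRing) 2 (fun k => m k * rho ^ k)), ex_series_Rabs, entire_ex_series, Hm. }
  assert (Hs : ex_series (fun k => Rabs (a k * x ^ k - b k * x ^ k))).
  { apply (ex_series_le (V := R_CompleteNormedModule)) with (2 := Hms).
    intros k. unfold norm; simpl. unfold abs; simpl. rewrite Rabs_Rabsolu. apply Hterm. }
  rewrite (Series_incr_n _ (S N)) by (lia || now apply ex_series_Rabs).
  rewrite sum_eq_R0 by (simpl; intros k Hk; rewrite Hab by lia; ring).
  rewrite Rplus_0_l.
  assert (Hs' := proj1 (ex_series_incr_n _ (S N)) Hs).
  eapply Rle_trans; [apply Series_Rabs, Hs'|].
  rewrite <- Series_scal_l. apply Series_le.
  - intros k; split; [apply Rabs_pos | apply Hterm].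
  - apply (proj1 (ex_series_incr_n _ (S N)) Hms).
Qed.

Lemma Series_tail_small (a : nat -> R) (eps : R) :
  ex_series a -> 0 < eps ->
  exists N, forall n, (N <= n)%nat -> Rabs (Series (fun k => a (S n + k)%nat)) < eps.
Proof.
  intros Ha Heps.
  pose proof (Series_correct _ Ha) as H.
  apply is_series_Reals in H. destruct (H eps Heps) as [N HN].
  exists N. intros n Hn. specialize (HN n Hn).
  unfold Rdist in HN. rewrite (Series_incr_n a (S n)) in HN by (lia || assumption).
  simpl pred in HN. rewrite Rabs_minus_sym in HN.
  replace (Series (fun k => a (S n + k)%nat))
    with (sum_f_R0 a n + Series (fun k => a (S n + k)%nat) - sum_f_R0 a n) by ring.
  exact HN.
Qed.

Lemma vim_series_unif_cv (rho eps : R) :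
  0 < rho -> 0 < eps ->
  exists N, forall n, (N <= n)%nat -> forall r, - rho <= r <= rho ->
    Rabs (PSeries (vim_coef n) r - PSeries airy_coef r) < eps.
Proof.
  intros Hrho Heps.
  assert (Hm : ex_series (fun k => airy_majorant k * rho ^ k))
    by apply ex_series_Rabs, entire_ex_series, airy_majorant_entire.
  (* Half of [eps] absorbs the factor 2 of the tail estimate. *)
  destruct (Series_tail_small _ (eps / 2) Hm) as [N HN]; [lra|].
  exists N. intros n Hn r Hr. specialize (HN n Hn). apply Rabs_lt_between in HN.
  eapply Rle_lt_trans.
  - apply (PSeries_diff_tail _ _ airy_majorant n r rho).
    + apply vim_coef_le_majorant.
    + apply airy_coef_le_majorant.
    + apply airy_majorant_entire.
    (* Agreement through degree [2n + 1] covers the degrees up to [n] required here. *)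
    + intros k Hk. apply vim_coef_stable. lia.
    + apply Rabs_le; lra.
  - cbv beta in HN. lra.
Qed.

(** * Closed form and convergence of the iterates *)

Lemma Derive_n_2_unique (f f1 : R -> R) (x l : R) :
  (forall y, is_derive f y (f1 y)) -> is_derive f1 x l -> Derive_n f 2 x = l.
Proof.
  intros Hf Hf1. change (Derive (fun y => Derive (fun z => f z) y) x = l).
  rewrite (Derive_ext _ f1) by (intros y; apply is_derive_unique, Hf).
  now apply is_derive_unique.
Qed.

Lemma expi_scal (t y : R) : (expi t * RtoC y)%C = (cos t * y, sin t * y).
Proof. unfold expi, Cmult, RtoC; simpl. f_equal; ring. Qed.

Lemma CDerive2_ext (f g : R -> C) (x : R) :
  (forall y, f y = g y) -> CDerive2 f x = CDerive2 g x.
Proof. intros H. unfold CDerive2. f_equal; apply Derive_n_ext; intros y; now rewrite H. Qed.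

Lemma CDerive2_pair (f g f1 g1 : R -> R) (x a b : R) :
  (forall y, is_derive f y (f1 y)) -> is_derive f1 x a ->
  (forall y, is_derive g y (g1 y)) -> is_derive g1 x b ->
  CDerive2 (fun y => (f y, g y)) x = (a, b).
Proof.
  intros Hf Hf1 Hg Hg1. change ((Derive_n f 2 x, Derive_n g 2 x) = (a, b)).
  now rewrite (Derive_n_2_unique f f1 x a), (Derive_n_2_unique g g1 x b).
Qed.

(** On [e^{it} F] the operator [- d^2/dt^2] is the identity, which produces the middle summand
    [F s]; the phase factors out of both components. *)
Lemma vim_rhs (F F1 : R -> R) (F2 s t l : R) :
  (forall y, is_derive F y (F1 y)) -> is_derive F1 s F2 ->
  (RtoC l * (CDerive2 (fun x => ((cos t * F x)%R, (sin t * F x)%R)) s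
   - CDerive2 (fun x => ((cos x * F s)%R, (sin x * F s)%R)) t
   + RtoC s * ((cos t * F s)%R, (sin t * F s)%R)))%C
  = (cos t * (l * (F2 + F s + s * F s)), sin t * (l * (F2 + F s + s * F s))).
Proof.
  intros HF HF1.
  rewrite (CDerive2_pair _ _ (fun y => cos t * F1 y) (fun y => sin t * F1 y)
             s (cos t * F2) (sin t * F2)).
  rewrite (CDerive2_pair _ _ (fun y => - sin y * F s) (fun y => cos y * F s)
             t (- cos t * F s) (- sin t * F s)).
  { unfold Cmult, Cplus, Cminus, Copp, RtoC; simpl. f_equal; ring. }
  all: intros; try (auto_derive; [easy | ring]).
  all: now apply is_derive_scal.
Qed.

(* With [L] solving [L'' + s L = 0], [L r = 0], [L' r = 1], Lagrange's identity
   makes [L (F' - G') - L' (F - G)] an antiderivative of the integrand. *)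
Lemma vim_step_integral (L L1 F F1 F2 G G1 G2 : R -> R) (r : R) :
  (forall s, is_derive L s (L1 s)) -> (forall s, is_derive L1 s (- s * L s)) ->
  L r = 0 -> L1 r = 1 ->
  (forall s, is_derive F s (F1 s)) -> (forall s, is_derive F1 s (F2 s)) ->
  (forall s, continuous F2 s) ->
  (forall s, is_derive G s (G1 s)) -> (forall s, is_derive G1 s (G2 s)) ->
  (forall s, G2 s + s * G s + F s = 0) -> F 0 = G 0 -> F1 0 = G1 0 ->
  is_RInt (fun s => L s * (F2 s + F s + s * F s)) 0 r (G r - F r).
Proof.
  intros HL HL1 Lr L1r HF HF1 HF2 HG HG1 HODE E0 E1.
  (* The antiderivative vanishes at 0, where [F] and [G] share value and slope, and at [r] it equals
     [G r - F r] because [L r = 0] and [L1 r = 1]. *)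
  replace (G r - F r) with
    (minus (L r * (F1 r - G1 r) - L1 r * (F r - G r))
           (L 0 * (F1 0 - G1 0) - L1 0 * (F 0 - G 0)))
    by (unfold minus, plus, opp; simpl; rewrite Lr, L1r, E0, E1; ring).
  apply (is_RInt_derive (V := R_CompleteNormedModule)
           (fun s => L s * (F1 s - G1 s) - L1 s * (F s - G s))); intros s _.
  (* The equation for [G] removes [G2] from the derivative; the first-order products cancel, and so
     do the terms in [s * G s]. *)
  - assert (HG2 : G2 s = - s * G s - F s) by (specialize (HODE s); lra).
    specialize (HL s); specialize (HL1 s); specialize (HF s); specialize (HF1 s);
      specialize (HG s); specialize (HG1 s).
    auto_derive.
    + repeat split; eexists; eassumption.
    + rewrite (is_derive_unique (fun x : R => L x) _ _ HL), (is_derive_unique (fun x : R => L1 x) _ _ HL1),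
        (is_derive_unique (fun x : R => F x) _ _ HF), (is_derive_unique (fun x : R => F1 x) _ _ HF1),
        (is_derive_unique (fun x : R => G x) _ _ HG), (is_derive_unique (fun x : R => G1 x) _ _ HG1), HG2. ring.
  - assert (CF : continuous F s)
      by (apply (ex_derive_continuous (V := R_NormedModule)); eexists; apply HF).
    apply (continuous_mult (K := R_AbsRing)).
    + apply (ex_derive_continuous (V := R_NormedModule)); eexists; apply HL.
    + apply (continuous_plus (V := R_NormedModule)).
      * apply (continuous_plus (V := R_NormedModule)); auto.
      * apply (continuous_mult (K := R_AbsRing)); [apply continuous_id | exact CF].
Qed.

Definition lagrange_mult_ds (r s : R) : R := PSeries (PS_derive (fun k => alpha k r)) (s - r).

Lemma lagrange_mult_derive (r s : R) : is_derive (lagrange_mult r) s (lagrange_mult_ds r s).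
Proof.
  replace (lagrange_mult_ds r s) with (scal 1 (lagrange_mult_ds r s))
    by (unfold scal; simpl; unfold mult; simpl; ring).
  apply (is_derive_comp (V := R_NormedModule) (PSeries (fun k => alpha k r)) (fun x => x - r)).
  - apply entire_is_derive, alpha_entire.
  - auto_derive; [easy | ring].
Qed.

(** The equation with coefficient [r + x] is evaluated at [x = s - r], where that coefficient is
    [s]. *)
Lemma lagrange_mult_derive2 (r s : R) :
  is_derive (lagrange_mult_ds r) s (- s * lagrange_mult r s).
Proof.
  replace (- s * lagrange_mult r s) with
    (scal 1 (PSeries (PS_derive (PS_derive (fun k => alpha k r))) (s - r))).
  - apply (is_derive_comp (V := R_NormedModule) (PSeries (PS_derive (fun k => alpha k r))) (fun x => x - r)).
    + apply entire_is_derive, entire_derive, alpha_entire.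
    + auto_derive; [easy | ring].
  - assert (E0 : entire (fun _ => 0)).
    { apply (entire_dominated _ airy_majorant); [|apply airy_majorant_entire].
      intros k. rewrite Rabs_R0. eapply Rle_trans; [apply Rabs_pos | apply airy_coef_le_majorant]. }
    pose proof (airy_rec_ode r _ _ (s - r) (alpha_rec r) (alpha_entire r) E0) as H.
    rewrite PSeries_const_0 in H.
    change (lagrange_mult r s) with (PSeries (fun k => alpha k r) (s - r)).
    unfold scal; simpl; unfold mult; simpl. lra.
Qed.

(** By induction, the correction integral is [e^{it}] times the difference of consecutive radial
    factors. *)
Lemma vim_closed_form (n : nat) (r t : R) :
  vim n r t = (cos t * PSeries (vim_coef n) r, sin t * PSeries (vim_coef n) r).
Proof.
  revert r t; induction n as [|n IH]; intros r t.
  - assert (H : PSeries (vim_coef 0) r = 1).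
    { rewrite PSeries_decr_1 by apply entire_ex_pseries, vim_coef_entire.
      rewrite (PSeries_ext (PS_decr_1 _) (fun _ => 0)) by reflexivity.
      rewrite PSeries_const_0. simpl. ring. }
    rewrite H, !Rmult_1_r. reflexivity.
  - simpl vim. set (F := PSeries (vim_coef n)). set (G := PSeries (vim_coef (S n))).
    pose proof (vim_coef_entire n) as Hn. pose proof (vim_coef_entire (S n)) as HSn.
    set (F2 := PSeries (PS_derive (PS_derive (vim_coef n)))).
    set (I := fun s => lagrange_mult r s * (F2 s + F s + s * F s)).
    assert (HI : is_RInt I 0 r (G r - F r)).
    { apply vim_step_integral with
        (L1 := lagrange_mult_ds r) (F1 := PSeries (PS_derive (vim_coef n)))
        (G1 := PSeries (PS_derive (vim_coef (S n))))
        (G2 := PSeries (PS_derive (PS_derive (vim_coef (S n))))).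
      - apply lagrange_mult_derive.
      - apply lagrange_mult_derive2.
      (* At [s = r] only the leading coefficients survive: [alpha 0 r = 0] is the value and
         [alpha 1 r = 1] the slope. *)
      - unfold lagrange_mult. rewrite Rminus_diag. apply PSeries_0.
      - unfold lagrange_mult_ds. rewrite Rminus_diag, PSeries_0.
        unfold PS_derive; simpl. ring.
      - intros s; now apply entire_is_derive.
      - intros s; now apply entire_is_derive, entire_derive.
      - intros s; now apply entire_continuous, entire_derive, entire_derive.
      - intros s; now apply entire_is_derive.
      - intros s; now apply entire_is_derive, entire_derive.
      (* The recurrence of [airy_solve] has [p = 0], so the factor [s] is first written as
         [0 + s]. *)
      - intros s. rewrite <- (Rplus_0_l s) at 2. apply airy_rec_ode; auto. apply airy_solve_rec.
      - unfold F, G. rewrite !PSeries_0. destruct n; reflexivity.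
      - rewrite !PSeries_0. unfold PS_derive. destruct n; reflexivity. }
    rewrite (RInt_ext (V := C_R_CompleteNormedModule) _ (fun s => (cos t * I s, sin t * I s))).
    (* The induction hypothesis enters as an identity of functions of each variable separately,
       since it is used under both second derivatives. *)
    2:{ intros s _. etransitivity; [|apply (vim_rhs F (PSeries (PS_derive (vim_coef n))))].
        - now rewrite (CDerive2_ext _ _ s (fun x => IH x t)),
            (CDerive2_ext (fun x => vim n s x) _ t (fun x => IH s x)), IH.
        - intros y; now apply entire_is_derive.
        - now apply entire_is_derive, entire_derive. }
    rewrite (is_RInt_unique (V := C_R_CompleteNormedModule) _ 0 r
               (cos t * (G r - F r), sin t * (G r - F r))).
    + rewrite IH. fold F. unfold Cplus; simpl. f_equal; ring.
    + apply (is_RInt_fct_extend_pair (U := R_NormedModule) (V := R_NormedModule));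
        now apply (is_RInt_scal (V := R_NormedModule) I).
Qed.

Lemma kg_series_closed_form (r t : R) :
  kg_series r t = (cos t * PSeries airy_coef r, sin t * PSeries airy_coef r).
Proof. apply expi_scal. Qed.

Lemma Cmod_expi (t : R) : Cmod (expi t) = 1.
Proof.
  unfold Cmod, expi; simpl. rewrite !Rmult_1_r.
  replace (cos t * cos t + sin t * sin t) with 1; [apply sqrt_1|].
  rewrite <- (sin2_cos2 t). unfold Rsqr. ring.
Qed.

(** The error is [e^{it}] times a real number depending on [r] alone, and [|e^{it}| = 1]; this gives
    uniformity over all real [t]. *)
Lemma vim_unif_cv (rho eps : R) :
  0 < rho -> 0 < eps ->
  exists N, forall n, (N <= n)%nat -> forall r t, - rho <= r <= rho ->
    Cmod (vim n r t - kg_series r t)%C < eps.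
Proof.
  intros Hrho Heps. destruct (vim_series_unif_cv rho eps Hrho Heps) as [N HN].
  exists N. intros n Hn r t Hr.
  replace (vim n r t - kg_series r t)%C
    with (expi t * RtoC (PSeries (vim_coef n) r - PSeries airy_coef r))%C.
  - rewrite Cmod_mult, Cmod_expi, Cmod_R, Rmult_1_l. now apply HN.
  - rewrite vim_closed_form, kg_series_closed_form, expi_scal.
    unfold Cminus, Cplus, Copp; simpl. f_equal; ring.
Qed.

(** * The Airy series solves the problem *)

(** Decomposition along 1 and [i], by which calculus for pairs reduces to sums and scalar multiples
    of fixed vectors. *)
Lemma pair_scal_basis (x y : R) :
  (x, y) = plus (scal x ((1, 0) : C_R_NormedModule)) (scal y ((0, 1) : C_R_NormedModule)).
Proof.
  unfold plus, scal; simpl. unfold prod_plus, prod_scal, scal, plus; simpl. unfold mult; simpl.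
  f_equal; ring.
Qed.

Lemma is_derive_C_pair (f g : R -> R) (x a b : R) :
  is_derive f x a -> is_derive g x b ->
  is_derive (fun y => (f y, g y) : C_R_NormedModule) x (a, b).
Proof.
  intros Hf Hg. rewrite pair_scal_basis.
  apply (is_derive_ext
           (fun y => plus (scal (f y) ((1, 0) : C_R_NormedModule)) (scal (g y) ((0, 1) : C_R_NormedModule)))).
  - intros y; symmetry; apply pair_scal_basis.
  - apply (is_derive_plus (V := C_R_NormedModule)); now apply (is_derive_scal_l (V := C_R_NormedModule)).
Qed.

Lemma continuous_C_pair {U : UniformSpace} (f g : U -> R) (x : U) :
  continuous f x -> continuous g x ->
  continuous (fun y => (f y, g y) : C_R_NormedModule) x.
Proof.
  intros Hf Hg.
  apply (continuous_ext
           (fun y => plus (scal (f y) ((1, 0) : C_R_NormedModule)) (scal (g y) ((0, 1) : C_R_NormedModule)))).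
  - intros y; symmetry; apply pair_scal_basis.
  - apply (continuous_plus (V := C_R_NormedModule));
      apply (continuous_scal (V := C_R_NormedModule)); auto using continuous_const.
Qed.

Lemma within_proper_at {T : UniformSpace} (D : T -> Prop) (x : T) :
  D x -> ProperFilter (within D (locally x)).
Proof.
  intros Hx. constructor; [|apply within_filter, locally_filter].
  intros P HP. exists x. exact (locally_singleton x _ HP Hx).
Qed.

Lemma is_derive_within (f : R -> C_R_NormedModule) (D : R -> Prop) (x : R) (l : C) :
  D x -> is_derive f x l ->
  filterdiff f (within D (locally x)) (fun h : R => scal h (l : C_R_NormedModule)).
Proof.
  intros Hx Hf. apply (filterdiff_locally (FF := within_proper_at D x Hx) f x); [|exact Hf].
  intros P HP. now apply filter_le_within.
Qed.

(** The factors are regular on the whole line, so the statements within [D] follow from the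
    two-sided ones by restricting the filter. *)
Lemma C1_in_separated (D : R * R -> Prop) (p a b p' a' b' : R -> R) :
  (forall x, is_derive p x (p' x)) -> (forall x, is_derive a x (a' x)) ->
  (forall x, is_derive b x (b' x)) -> (forall x, continuous p' x) ->
  (forall x, continuous a' x) -> (forall x, continuous b' x) ->
  C1_in D (fun r t => (a t * p r, b t * p r))
          (fun r t => (a t * p' r, b t * p' r)) (fun r t => (a' t * p r, b' t * p r)).
Proof.
  intros Hp Ha Hb Cp' Ca' Cb'.
  assert (C : forall f g h : R -> R, (forall x, continuous f x) -> (forall x, continuous g x) ->
            (forall x, continuous h x) -> continuous_in D (fun r t => (f t * h r, g t * h r))).
  { intros f g h Cf Cg Ch r t _.
    apply (filterlim_filter_le_1 _ (filter_le_within (F := locally ((r, t) : R * R)) D)).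
    apply (continuous_C_pair (fun q : R * R => f (snd q) * h (fst q))
             (fun q : R * R => g (snd q) * h (fst q)));
      apply (continuous_mult (K := R_AbsRing)).
    1, 3: apply (continuous_comp (snd : R * R -> R)); [apply continuous_snd | auto].
    all: apply (continuous_comp (fst : R * R -> R)); [apply continuous_fst | auto]. }
  assert (Cd : forall f f' : R -> R, (forall x, is_derive f x (f' x)) -> forall x, continuous f x)
    by (intros f f' Hf x; apply (ex_derive_continuous (V := R_NormedModule)); eexists; apply Hf).
  split; [|split; [|split; [|split]]]; try (apply C; eauto).
  - intros r t Ht. apply (is_derive_within _ (fun x => D (x, t))); [exact Ht|].
    apply is_derive_C_pair; now apply is_derive_scal.
  - intros r t Ht. apply (is_derive_within _ (fun x => D (r, x))); [exact Ht|].
    apply is_derive_C_pair; now apply (is_derive_scal_l (V := R_NormedModule)).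
Qed.

Lemma kg_series_solution : kg_solution kg_series.
Proof.
  replace kg_series with (fun r t => (cos t * PSeries airy_coef r, sin t * PSeries airy_coef r))
    by (do 2 (apply functional_extensionality; intro); now rewrite kg_series_closed_form).
  pose proof airy_coef_entire as E0.
  pose proof (entire_derive _ E0) as E1. pose proof (entire_derive _ E1) as E2.
  set (A := PSeries airy_coef). set (A1 := PSeries (PS_derive airy_coef)).
  set (A2 := PSeries (PS_derive (PS_derive airy_coef))).
  assert (DA : forall x, is_derive A x (A1 x)) by (intros; now apply entire_is_derive).
  assert (DA1 : forall x, is_derive A1 x (A2 x)) by (intros; now apply entire_is_derive).
  assert (CA1 : forall x, continuous A1 x) by (intros; now apply entire_continuous).
  assert (CA2 : forall x, continuous A2 x) by (intros; now apply entire_continuous).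
  assert (Dcos : forall x, is_derive cos x (- sin x)) by (intros; apply is_derive_Reals, derivable_pt_lim_cos).
  assert (Dsin : forall x, is_derive sin x (cos x)) by (intros; apply is_derive_Reals, derivable_pt_lim_sin).
  assert (Dmsin : forall x, is_derive (fun y => - sin y) x (- cos x)) by (intros; now apply (is_derive_opp sin)).
  assert (Ccos : forall x, continuous cos x) by (intros; apply continuous_cos).
  assert (Csin : forall x, continuous sin x) by (intros; apply continuous_sin).
  assert (Cmsin : forall x, continuous (fun y => - sin y) x) by (intros; now apply (continuous_opp sin)).
  assert (Cmcos : forall x, continuous (fun y => - cos y) x) by (intros; now apply (continuous_opp cos)).
  exists (fun r t => (cos t * A1 r, sin t * A1 r)), (fun r t => (- sin t * A r, cos t * A r)),
    (fun r t => (cos t * A2 r, sin t * A2 r)), (fun r t => (- sin t * A1 r, cos t * A1 r)),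
    (fun r t => (- sin t * A1 r, cos t * A1 r)), (fun r t => (- cos t * A r, - sin t * A r)).
  split; [|split; [|split; [|split; [|split]]]].
  - now apply C1_in_separated.
  - now apply C1_in_separated.
  - now apply (C1_in_separated _ A (fun t => - sin t) cos A1 (fun t => - cos t) (fun t => - sin t)).
  - intros r t _.
    assert (Z : entire (fun _ => 0)).
    { apply (airy_rec_entire 0). split; intros; ring. }
    pose proof (airy_rec_ode 1 _ _ r airy_coef_rec E0 Z) as H. rewrite PSeries_const_0 in H.
    fold A A2 in H.
    assert (H2 : A2 r = - (1 + r) * A r) by lra.
    rewrite H2. unfold Cmult, Cplus, Cminus, Copp, RtoC; simpl. f_equal; ring.
  - intros t. unfold A. rewrite PSeries_0. unfold expi; simpl. f_equal; ring.
  - intros t. unfold A1. rewrite PSeries_0. unfold PS_derive; simpl. unfold RtoC. f_equal; ring.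
Qed.

(** * Uniqueness by characteristics *)

Lemma Rmax_0_contract (x y : R) : Rabs (Rmax 0 y - Rmax 0 x) <= Rabs (y - x).
Proof. unfold Rmax; repeat destruct Rle_dec; unfold Rabs; repeat destruct Rcase_abs; lra. Qed.

Lemma continuous_Rmax_0 (x : R) : continuous (Rmax 0) x.
Proof.
  apply filterlim_locally. intros eps. exists eps. intros y Hy.
  apply Rle_lt_trans with (2 := Hy). apply Rmax_0_contract.
Qed.

(* [h (Rmax 0 _)] lets one-sided continuity of [h] at 0 be stated with two-sided limits. *)
Lemma growth_bound (h dh : R -> R) (A r : R) (n : nat) :
  0 <= r -> (forall x, continuous (fun y => h (Rmax 0 y)) x) ->
  (forall x, 0 < x < r -> is_derive h x (dh x)) ->
  (forall x, 0 < x < r -> Rabs (dh x) <= A * x ^ n) -> h 0 = 0 ->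
  Rabs (h r) <= A / INR (S n) * r ^ S n.
Proof.
  intros Hr Hc Hd Hb H0.
  assert (HS : INR (S n) <> 0) by (apply not_0_INR; lia).
  set (P := fun x => A / INR (S n) * x ^ S n).
  assert (HP0 : P 0 = 0) by (unfold P; rewrite pow_i by lia; ring).
  assert (DP : forall x, is_derive P x (A * x ^ n)).
  { intros x. unfold P. auto_derive; [easy|]. simpl pred. field. exact HS. }
  (* The signs [s = 1] and [s = -1] give the two halves of the bound; [P] is the antiderivative of
     [A * x ^ n] that vanishes at 0. *)
  assert (Hpos : forall s, Rabs s = 1 -> 0 <= P r - s * h r).
  { intros s Hs.
    set (k := fun x => P x - s * h (Rmax 0 x)).
    assert (Hk0 : k 0 = 0) by (unfold k; rewrite Rmax_left, H0, HP0 by lra; ring).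
    assert (Hkr : k r = P r - s * h r) by (unfold k; now rewrite Rmax_right).
    rewrite <- Hkr.
    (* The mean value point may be an endpoint, where nothing is known about [dh]. Clamping the
       derivative keeps it nonnegative there and changes nothing in the open interval. *)
    destruct (MVT_gen k 0 r (fun x => Rmax 0 (A * x ^ n - s * dh x))) as [c [_ Hc2]].
    - rewrite Rmin_left, Rmax_right by lra. intros x Hx.
      rewrite Rmax_right.
      + apply (is_derive_minus (V := R_NormedModule)); [apply DP|].
        apply (is_derive_scal (fun y => h (Rmax 0 y))).
        apply (is_derive_ext_loc h); [|now apply Hd].
        apply (filter_imp (Rlt 0)); [|now apply open_gt].
        intros y Hy. now rewrite Rmax_right by lra.
      + specialize (Hb x Hx). pose proof (Rle_abs (s * dh x)) as Ha.
        rewrite Rabs_mult, Hs in Ha. lra.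
    - intros x _. apply continuity_pt_filterlim.
      apply (continuous_minus (V := R_NormedModule)).
      + apply (ex_derive_continuous (V := R_NormedModule)). eexists; apply DP.
      + apply (continuous_scal_r (V := R_NormedModule)), Hc.
    - rewrite Hk0 in Hc2.
      assert (0 <= Rmax 0 (A * c ^ n - s * dh c) * (r - 0))
        by (apply Rmult_le_pos; [apply Rmax_l | lra]).
      lra. }
  pose proof (Hpos 1 Rabs_R1). pose proof (Hpos (-1) ltac:(rewrite Rabs_left; lra)).
  apply Rabs_le. fold (P r). lra.
Qed.

(** Chain rule on the line [y |-> (y, c - s y)]. Joint differentiability comes from continuity of
    the first partial derivative together with existence of the second at the point. *)
Lemma is_derive_along (g gr : R -> R -> R) (gt c s x : R) :
  locally (x, c - s * x) (fun p : R * R => is_derive (fun z => g z (snd p)) (fst p) (gr (fst p) (snd p))) ->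
  is_derive (fun z => g x z) (c - s * x) gt ->
  continuous (fun p : R * R => gr (fst p) (snd p)) (x, c - s * x) ->
  is_derive (fun y => g y (c - s * y)) x (gr x (c - s * x) - s * gt).
Proof.
  intros Hr Ht Hc.
  pose proof (is_derive_filterdiff g x (c - s * x) gr gt Hr Ht Hc) as H.
  assert (Hline : is_derive (fun y => c - s * y) x (- s)) by (auto_derive; [easy | ring]).
  eapply filterdiff_ext_lin.
  - apply (filterdiff_comp'_2 (fun y : R_NormedModule => y) (fun y : R_NormedModule => c - s * y)
             g x (fun y => y) (fun y => scal y (- s))
             (fun a b => plus (scal a (gr x (c - s * x))) (scal b gt))).
    + apply filterdiff_id.
    + exact Hline.
    + exact H.
  - intros y. unfold plus, scal; simpl. unfold mult; simpl. ring.
Qed.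

Lemma locally_right_half_plane (r t : R) :
  0 < r -> locally ((r, t) : R * R) (fun p => 0 < fst p).
Proof.
  intros Hr. exists (mkposreal r Hr). intros [x y] [H _].
  unfold ball in H; simpl in H. unfold AbsRing_ball, abs, minus, plus, opp in H; simpl in H |- *.
  apply Rabs_lt_between in H. lra.
Qed.

Lemma continuous_along_half_line (g : R -> R -> R) (c s x : R) :
  (forall r t, continuous (fun p : R * R => g (Rmax 0 (fst p)) (snd p)) (r, t)) ->
  continuous (fun y => g (Rmax 0 y) (c - s * Rmax 0 y)) x.
Proof.
  intros Hg.
  apply (continuous_comp_2 (fun y : R => y) (fun y => c - s * Rmax 0 y) (fun a b => g (Rmax 0 a) b)).
  - apply continuous_id.
  - apply (continuous_minus (V := R_NormedModule)); [apply continuous_const|].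
    apply (continuous_scal_r (V := R_NormedModule)), continuous_Rmax_0.
  - apply Hg.
Qed.

Section Wave.

Variables w wr wt wrr wrt wtr wtt : R -> R -> R.
Hypothesis Dw_r : forall r t, 0 < r -> is_derive (fun x => w x t) r (wr r t).
Hypothesis Dw_t : forall r t, 0 < r -> is_derive (fun x => w r x) t (wt r t).
Hypothesis Dwr_r : forall r t, 0 < r -> is_derive (fun x => wr x t) r (wrr r t).
Hypothesis Dwr_t : forall r t, 0 < r -> is_derive (fun x => wr r x) t (wrt r t).
Hypothesis Dwt_r : forall r t, 0 < r -> is_derive (fun x => wt x t) r (wtr r t).
Hypothesis Dwt_t : forall r t, 0 < r -> is_derive (fun x => wt r x) t (wtt r t).
Hypothesis Cw : forall r t, continuous (fun p : R * R => w (Rmax 0 (fst p)) (snd p)) (r, t).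
Hypothesis Cwr : forall r t, continuous (fun p : R * R => wr (Rmax 0 (fst p)) (snd p)) (r, t).
Hypothesis Cwt : forall r t, continuous (fun p : R * R => wt (Rmax 0 (fst p)) (snd p)) (r, t).
Hypothesis Cwrr : forall r t, 0 < r -> continuous (fun p : R * R => wrr (fst p) (snd p)) (r, t).
Hypothesis Cwrt : forall r t, 0 < r -> continuous (fun p : R * R => wrt (fst p) (snd p)) (r, t).
Hypothesis Cwtr : forall r t, 0 < r -> continuous (fun p : R * R => wtr (fst p) (snd p)) (r, t).
Hypothesis PDE : forall r t, 0 < r -> wrr r t - wtt r t + r * w r t = 0.
Hypothesis w_0 : forall t, w 0 t = 0.
Hypothesis wr_0 : forall t, wr 0 t = 0.
Hypothesis wt_0 : forall t, wt 0 t = 0.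

(** Schwarz's theorem, applied after identifying the iterated [Derive] with the given functions on
    the open half-plane. *)
Lemma mixed_partials_eq (r t : R) : 0 < r -> wrt r t = wtr r t.
Proof.
  intros Hr.
  assert (Etr : forall u v, 0 < u -> Derive (fun z => Derive (fun x => w z x) v) u = wtr u v).
  { intros u v Hu. apply is_derive_unique. apply (is_derive_ext_loc (fun z => wt z v)).
    - apply (filter_imp (Rlt 0)); [|now apply open_gt].
      intros z Hz. symmetry. now apply is_derive_unique, Dw_t.
    - now apply Dwt_r. }
  assert (Ert : forall u v, 0 < u -> Derive (fun z => Derive (fun x => w x z) u) v = wrt u v).
  { intros u v Hu. apply is_derive_unique. apply (is_derive_ext (fun z => wr u z)).
    - intros z. symmetry. now apply is_derive_unique, Dw_r.
    - now apply Dwr_t. }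
  assert (Hloc : forall Q : R -> R -> Prop, (forall u v, 0 < u -> Q u v) -> locally_2d Q r t).
  { intros Q HQ. apply locally_2d_locally.
    apply (filter_imp (fun p : R * R => 0 < fst p)); [|now apply locally_right_half_plane].
    intros [u v] Hu. now apply HQ. }
  rewrite <- Ert, <- Etr by exact Hr. symmetry. apply Schwarz.
  - apply Hloc. intros u v Hu. split; [|split; [|split]].
    + eexists; now apply Dw_r.
    + eexists; now apply Dw_t.
    + apply (ex_derive_ext_loc (fun z => wt z v)); [|eexists; now apply Dwt_r].
      apply (filter_imp (Rlt 0)); [|now apply open_gt].
      intros z Hz. symmetry. now apply is_derive_unique, Dw_t.
    + apply (ex_derive_ext (fun z => wr u z)); [|eexists; now apply Dwr_t].
      intros z. symmetry. now apply is_derive_unique, Dw_r.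
  - apply (continuity_2d_pt_ext_loc wtr); [apply Hloc; intros; symmetry; now apply Etr|].
    now apply continuity_2d_pt_filterlim, Cwtr.
  - apply (continuity_2d_pt_ext_loc wrt); [apply Hloc; intros; symmetry; now apply Ert|].
    now apply continuity_2d_pt_filterlim, Cwrt.
Qed.

(** The derivative is [wrr - s wrt + s wtr - s^2 wtt]; the mixed terms cancel, [s^2 = 1], and the
    equation replaces [wrr - wtt] by [- x w]. *)
Lemma derive_characteristic (s c x : R) :
  s * s = 1 -> 0 < x ->
  is_derive (fun y => wr y (c - s * y) + s * wt y (c - s * y)) x (- x * w x (c - s * x)).
Proof.
  intros Hs Hx.
  set (t := c - s * x).
  replace (- x * w x t) with
    (plus (wrr x t - s * wrt x t) (s * (wtr x t - s * wtt x t))).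
  - apply (is_derive_plus (V := R_NormedModule)); [|apply (is_derive_scal (fun y => wt y (c - s * y)))];
      (apply is_derive_along; auto;
       apply (filter_imp (fun p : R * R => 0 < fst p)); [|now apply locally_right_half_plane];
       intros; auto).
  - unfold plus; simpl. rewrite mixed_partials_eq by exact Hx.
    replace (wrr x t - s * wtr x t + s * (wtr x t - s * wtt x t))
      with (wrr x t - s * s * wtt x t) by ring.
    rewrite Hs. specialize (PDE x t Hx). lra.
Qed.

Lemma triangle_step (r0 t0 A : R) (n : nat) :
  (forall r t, 0 <= r <= r0 -> Rabs (t - t0) <= r0 - r -> Rabs (w r t) <= A * r ^ n) ->
  forall r t, 0 <= r <= r0 -> Rabs (t - t0) <= r0 - r ->
  Rabs (w r t) <= A * r0 / INR (S n) / INR (S (S n)) * r ^ S (S n).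
Proof.
  intros Hw.
  assert (Hchar : forall s r t, s * s = 1 -> Rabs s = 1 -> 0 <= r <= r0 -> Rabs (t - t0) <= r0 - r ->
    Rabs (wr r t + s * wt r t) <= A * r0 / INR (S n) * r ^ S n).
  (* This [c] makes the characteristic [y |-> (y, c - s y)] pass through [(r, t)]. *)
  { intros s r t Hs Hs1 Hr Ht. set (c := t + s * r).
    replace t with (c - s * r) at 1 2 by (unfold c; ring).
    apply (growth_bound (fun y => wr y (c - s * y) + s * wt y (c - s * y))
             (fun x => - x * w x (c - s * x))); [lra | | | |].
    - intros x. apply (continuous_plus (V := R_NormedModule));
        [|apply (continuous_scal_r (V := R_NormedModule))]; now apply continuous_along_half_line.
    - intros x Hx. now apply derive_characteristic.
    - intros x Hx. rewrite Rabs_mult, Rabs_Ropp, (Rabs_pos_eq x) by lra.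
      assert (Hwx : Rabs (w x (c - s * x)) <= A * x ^ n).
      (* Followed back to [r = 0], the characteristic stays in the triangle: the distance to [t0]
         grows by at most [r - x]. *)
      { apply Hw; [lra|]. replace (c - s * x - t0) with ((t - t0) + s * (r - x)) by (unfold c; ring).
        eapply Rle_trans; [apply Rabs_triang|].
        rewrite Rabs_mult, Hs1, (Rabs_pos_eq (r - x)) by lra. lra. }
      pose proof (Rabs_pos (w x (c - s * x))).
      replace (A * r0 * x ^ n) with (r0 * (A * x ^ n)) by ring.
      apply Rmult_le_compat; lra.
    - rewrite wr_0, wt_0. ring. }
  intros r t Hr Ht.
  apply (growth_bound (fun y => w y t) (fun x => wr x t)); [lra | | | |].
  - intros x. pose proof (continuous_along_half_line w t 0 x Cw) as H.
    apply (continuous_ext (fun y => w (Rmax 0 y) (t - 0 * Rmax 0 y))); [|exact H].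
    intros y. f_equal. ring.
  - intros x Hx. apply Dw_r. lra.
  - intros x Hx.
    assert (Hxt : Rabs (t - t0) <= r0 - x) by lra.
    (* [wr] is the mean of [wr + wt] and [wr - wt], so it inherits their common bound. *)
    pose proof (Hchar 1 x t ltac:(ring) Rabs_R1 ltac:(lra) Hxt) as H1.
    pose proof (Hchar (-1) x t ltac:(ring) ltac:(rewrite Rabs_left; lra) ltac:(lra) Hxt) as H2.
    apply Rabs_le. apply Rabs_le_between in H1. apply Rabs_le_between in H2. lra.
  - apply w_0.
Qed.

(** Uniform continuity on the enclosing rectangle supplies a [d] such that each step of length
    [d / 2] in [r] changes [w] by less than 1. Starting from [w 0 t = 0], finitely many steps reach
    [r0]. *)
Lemma triangle_bounded (r0 t0 : R) :
  exists M, forall r t, 0 <= r <= r0 -> Rabs (t - t0) <= r0 - r -> Rabs (w r t) <= M.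
Proof.
  destruct (uniform_continuity_2d (fun r t => w (Rmax 0 r) t) 0 r0 (t0 - r0) (t0 + r0)
              ltac:(intros; now apply continuity_2d_pt_filterlim, Cw) (mkposreal 1 Rlt_0_1))
    as [d Hd]. simpl in Hd.
  pose proof (cond_pos d) as Hd0.
  assert (Hstep : forall n r t, 0 <= r <= r0 -> t0 - r0 <= t <= t0 + r0 ->
            r <= INR n * (d / 2) -> Rabs (w r t) <= INR n).
  { induction n as [|n IH]; intros r t Hr Ht Hn.
    - simpl in Hn. replace r with 0 by lra. rewrite w_0, Rabs_R0. simpl; lra.
    - rewrite S_INR in *. set (r' := Rmax 0 (r - d / 2)).
      assert (Hr' : 0 <= r' <= r0 /\ r' <= INR n * (d / 2) /\ Rabs (r - r') < d).
      { pose proof (pos_INR n) as Hn0. assert (0 <= INR n * (d / 2)) by (apply Rmult_le_pos; lra).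
        unfold r', Rmax. destruct Rle_dec; (split; [lra | split; [lra|apply Rabs_lt_between; lra]]). }
      destruct Hr' as [Hr1 [Hr2 Hr3]].
      specialize (IH r' t Hr1 Ht Hr2).
      specialize (Hd r' t r t Hr1 Ht Hr Ht Hr3 ltac:(rewrite Rminus_diag, Rabs_R0; exact Hd0)).
      rewrite !Rmax_right in Hd by lra.
      replace (w r t) with (w r' t + (w r t - w r' t)) by ring.
      eapply Rle_trans; [apply Rabs_triang | lra]. }
  destruct (INR_unbounded (r0 / (d / 2))) as [N HN].
  exists (INR N). intros r t Hr Ht. apply Rabs_le_between in Ht. apply Hstep; [lra | lra |].
  apply Rle_trans with r0; [lra|].
  apply (Rmult_lt_compat_r (d / 2)) in HN; [|lra].
  replace (r0 / (d / 2) * (d / 2)) with r0 in HN by (field; lra). lra.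
Qed.

(** Iterating the triangle estimate [k] times and evaluating at the apex gives
    [|w| <= M (r0^3)^k / (2k)!], which tends to 0. *)
Lemma wave_null (r0 t0 : R) : 0 <= r0 -> w r0 t0 = 0.
Proof.
  intros Hr0. destruct (triangle_bounded r0 t0) as [M HM].
  assert (Hit : forall k r t, 0 <= r <= r0 -> Rabs (t - t0) <= r0 - r ->
            Rabs (w r t) <= M * r0 ^ k / INR (fact (2 * k)) * r ^ (2 * k)).
  { induction k as [|k IH]; intros r t Hr Ht.
    - specialize (HM r t Hr Ht). simpl. lra.
    - pose proof (triangle_step r0 t0 _ _ IH r t Hr Ht) as H.
      replace (2 * S k)%nat with (S (S (2 * k))) by lia.
      eapply Rle_trans; [exact H|]. apply Req_le. f_equal.
      rewrite !fact_simpl, !mult_INR. simpl (r0 ^ S k). field.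
      repeat split; try apply INR_fact_neq_0; apply not_0_INR; lia. }
  assert (HM0 : 0 <= M).
  { eapply Rle_trans; [apply Rabs_pos | apply (HM 0 t0); [lra|]]. rewrite Rminus_diag, Rabs_R0. lra. }
  destruct (Req_dec (w r0 t0) 0) as [|Hne]; [assumption | exfalso].
  pose proof (Rabs_pos_lt _ Hne) as Hpos.
  (* Dividing by [M + 1] rather than [M] allows [M = 0]. The limit concerns [N!], which is at most
     [(2N)!]. *)
  destruct (cv_speed_pow_fact (r0 ^ 3) (Rabs (w r0 t0) / (M + 1))) as [N HN].
  { apply Rdiv_lt_0_compat; lra. }
  specialize (HN N (le_n N)). unfold Rdist in HN. rewrite Rminus_0_r in HN.
  assert (Hp3 : 0 <= (r0 ^ 3) ^ N) by now apply pow_le, pow_le.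
  assert (Hf : 0 < INR (fact N)) by apply INR_fact_lt_0.
  rewrite Rabs_pos_eq in HN by (apply Rdiv_le_0_compat; assumption).
  specialize (Hit N r0 t0 ltac:(lra) ltac:(rewrite !Rminus_diag, Rabs_R0; lra)).
  assert (Hle : M * r0 ^ N / INR (fact (2 * N)) * r0 ^ (2 * N) <= M * ((r0 ^ 3) ^ N / INR (fact N))).
  { replace (M * r0 ^ N / INR (fact (2 * N)) * r0 ^ (2 * N))
      with (M * ((r0 ^ 3) ^ N / INR (fact (2 * N)))).
    - apply Rmult_le_compat_l; [exact HM0|]. apply Rmult_le_compat_l; [exact Hp3|].
      apply Rinv_le_contravar; [exact Hf|]. apply le_INR, fact_le. lia.
    - rewrite <- pow_mult. replace (3 * N)%nat with (N + 2 * N)%nat by lia. rewrite pow_add.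
      field. apply INR_fact_neq_0. }
  apply (Rmult_lt_compat_l (M + 1)) in HN; [|lra].
  replace ((M + 1) * (Rabs (w r0 t0) / (M + 1))) with (Rabs (w r0 t0)) in HN by (field; lra).
  assert (0 <= (r0 ^ 3) ^ N / INR (fact N)) by (apply Rdiv_le_0_compat; assumption).
  lra.
Qed.

End Wave.

(** * Reduction of complex solutions to real components *)

Lemma continuous_in_minus (D : R * R -> Prop) (f g : R -> R -> C) :
  continuous_in D f -> continuous_in D g -> continuous_in D (fun r t => f r t - g r t)%C.
Proof.
  intros Hf Hg r t Ht.
  assert (FF : Filter (within D (locally ((r, t) : R * R)))) by apply within_filter, locally_filter.
  apply (filterlim_comp_2 (G := locally (f r t : C_R_NormedModule)) (H := locally (opp (g r t : C_R_NormedModule)))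
           (fun p : R * R => f (fst p) (snd p) : C_R_NormedModule)
           (fun p : R * R => opp (g (fst p) (snd p) : C_R_NormedModule)) plus).
  - now apply Hf.
  - apply (filterlim_comp _ _ _ (fun p : R * R => g (fst p) (snd p) : C_R_NormedModule) opp
             _ (locally (g r t : C_R_NormedModule))); [now apply Hg|].
    apply (filterlim_opp (V := C_R_NormedModule)).
  - apply (filterlim_plus (V := C_R_NormedModule)).
Qed.

Lemma filterdiff_scal_minus (F : (R -> Prop) -> Prop) (f g : R -> C_R_NormedModule) (a b : C) :
  Filter F ->
  filterdiff f F (fun h : R => scal h (a : C_R_NormedModule)) ->
  filterdiff g F (fun h : R => scal h (b : C_R_NormedModule)) ->
  filterdiff (fun x => (f x - g x)%C : C_R_NormedModule) F
    (fun h : R => scal h ((a - b)%C : C_R_NormedModule)).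
Proof.
  intros FF Hf Hg.
  apply (filterdiff_ext_lin _ (fun h : R => minus (scal h (a : C_R_NormedModule)) (scal h (b : C_R_NormedModule)))).
  - now apply (filterdiff_minus_fct (V := C_R_NormedModule) f g).
  - intros h. symmetry. apply (scal_minus_distr_l (V := C_R_NormedModule)).
Qed.

Lemma C1_in_minus (D : R * R -> Prop) (f fr ft g gr gt : R -> R -> C) :
  C1_in D f fr ft -> C1_in D g gr gt ->
  C1_in D (fun r t => f r t - g r t)%C (fun r t => fr r t - gr r t)%C (fun r t => ft r t - gt r t)%C.
Proof.
  intros (Fr & Ft & F0 & F1 & F2) (Gr & Gt & G0 & G1 & G2).
  split; [|split; [|split; [|split]]]; try now apply continuous_in_minus.
  - intros r t Ht. apply filterdiff_scal_minus; auto. apply within_filter, locally_filter.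
  - intros r t Ht. apply filterdiff_scal_minus; auto. apply within_filter, locally_filter.
Qed.

(** When [D] is a neighbourhood of [x], restricting to [D] does not change the limit; the linear map
    [pr] is then composed by the chain rule. *)
Lemma is_derive_of_within (f : R -> C_R_NormedModule) (D : R -> Prop) (x : R) (l : C) (pr : C -> R) :
  is_linear (pr : C_R_NormedModule -> R_NormedModule) -> locally x D ->
  filterdiff f (within D (locally x)) (fun h : R => scal h (l : C_R_NormedModule)) ->
  is_derive (fun y => pr (f y)) x (pr l).
Proof.
  intros Hpr HD [Hlin Hf].
  assert (Hloc : is_derive f x (l : C_R_NormedModule)).
  { split; [exact Hlin|]. intros y Hy eps.
    assert (Hy' : is_filter_lim (within D (locally x)) y)
      by (apply (is_filter_lim_filter_le y (filter_le_within (F := locally x) D)), Hy).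
    specialize (Hf y Hy' eps). unfold within in Hf.
    generalize (filter_and _ _ HD Hf). apply filter_imp. intros z [H1 H2]. now apply H2. }
  apply (filterdiff_ext_lin _ (fun h : R => pr (scal h (l : C_R_NormedModule)))).
  - apply (filterdiff_comp' f pr x _ pr Hloc). now apply filterdiff_linear.
  - intros h. apply (linear_scal _ Hpr).
Qed.

Lemma continuous_pr (pr : C -> R) (z : C_R_NormedModule) :
  is_linear (pr : C_R_NormedModule -> R_NormedModule) ->
  continuous (pr : C_R_NormedModule -> R_NormedModule) z.
Proof. intros H. apply filterdiff_continuous. exists pr. now apply filterdiff_linear. Qed.

Lemma continuous_in_interior (pr : C -> R) (D : R * R -> Prop) (f : R -> R -> C) (r t : R) :
  is_linear (pr : C_R_NormedModule -> R_NormedModule) ->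
  continuous_in D f -> locally ((r, t) : R * R) D ->
  continuous (fun p : R * R => pr (f (fst p) (snd p))) (r, t).
Proof.
  intros Hpr Hf HD.
  apply (continuous_comp (fun p : R * R => f (fst p) (snd p) : C_R_NormedModule) pr).
  - intros P HP. specialize (Hf r t (locally_singleton _ _ HD) P HP).
    unfold filtermap, within in Hf |- *.
    generalize (filter_and _ _ HD Hf). apply filter_imp. intros z [H1 H2]. now apply H2.
  - now apply continuous_pr.
Qed.

(** The clamp [Rmax 0] lands in the closed half-plane and does not increase distances, so the same
    radius works. *)
Lemma continuous_in_half_plane (pr : C -> R) (f : R -> R -> C) (r t : R) :
  is_linear (pr : C_R_NormedModule -> R_NormedModule) ->
  continuous_in (fun p => 0 <= fst p) f ->
  continuous (fun p : R * R => pr (f (Rmax 0 (fst p)) (snd p))) (r, t).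
Proof.
  intros Hpr Hf.
  apply (continuous_comp (fun p : R * R => f (Rmax 0 (fst p)) (snd p) : C_R_NormedModule) pr);
    [|now apply continuous_pr].
  intros P HP. specialize (Hf (Rmax 0 r) t (Rmax_l 0 r) P HP).
  destruct Hf as [eps Heps]. exists eps. intros [x y] [H1 H2].
  apply (Heps (Rmax 0 x, y)); [|apply Rmax_l]. split; [|exact H2].
  apply Rle_lt_trans with (2 := H1). apply Rmax_0_contract.
Qed.

(** The equation has real coefficients, so a real-linear [pr], such as [Re] or [Im], carries it to
    the real problem with zero data. *)
Lemma kg_null (pr : C -> R) (w wr wt wrr wrt wtr wtt : R -> R -> C) :
  is_linear (pr : C_R_NormedModule -> R_NormedModule) ->
  (forall x z, pr (RtoC x * z)%C = x * pr z) ->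
  C1_in (fun p => 0 <= fst p) w wr wt ->
  C1_in (fun p => 0 < fst p) wr wrr wrt ->
  C1_in (fun p => 0 < fst p) wt wtr wtt ->
  (forall r t, 0 < r -> (wrr r t - wtt r t + RtoC r * w r t)%C = 0%C) ->
  (forall t, w 0 t = 0%C) -> (forall t, wr 0 t = 0%C) ->
  forall r t, 0 <= r -> pr (w r t) = 0.
Proof.
  intros Hpr Hmul (W1 & W2 & W3 & W4 & W5) (R1 & R2 & R3 & R4 & R5) (T1 & T2 & T3 & T4 & T5)
    HPDE H0 H1.
  assert (Hpr0 : pr 0%C = 0) by apply (linear_zero _ Hpr).
  assert (Hge : forall r, 0 < r -> locally r (fun x => 0 <= x)).
  { intros r Hr. apply (filter_imp (Rlt 0)); [intros; lra | now apply open_gt]. }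
  assert (Hgt : forall r, 0 < r -> locally r (fun x => 0 < x)) by (intros; now apply open_gt).
  assert (Hall : forall (Q : Prop) (t : R), Q -> locally t (fun _ => Q)).
  { intros Q t HQ. now apply filter_forall. }
  apply (wave_null (fun r t => pr (w r t)) (fun r t => pr (wr r t)) (fun r t => pr (wt r t))
           (fun r t => pr (wrr r t)) (fun r t => pr (wrt r t)) (fun r t => pr (wtr r t))
           (fun r t => pr (wtt r t))).
  - intros r t Hr. apply (is_derive_of_within _ _ _ _ pr Hpr (Hge r Hr)). apply W1. simpl; lra.
  - intros r t Hr. apply (is_derive_of_within _ (fun _ => 0 <= r) _ _ pr Hpr); [apply Hall; lra|].
    apply W2. simpl; lra.
  - intros r t Hr. apply (is_derive_of_within _ _ _ _ pr Hpr (Hgt r Hr)). now apply R1.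
  - intros r t Hr. apply (is_derive_of_within _ (fun _ => 0 < r) _ _ pr Hpr); [now apply Hall|].
    now apply R2.
  - intros r t Hr. apply (is_derive_of_within _ _ _ _ pr Hpr (Hgt r Hr)). now apply T1.
  - intros r t Hr. apply (is_derive_of_within _ (fun _ => 0 < r) _ _ pr Hpr); [now apply Hall|].
    now apply T2.
  - intros r t. now apply continuous_in_half_plane.
  - intros r t. now apply continuous_in_half_plane.
  - intros r t. now apply continuous_in_half_plane.
  - intros r t Hr. now apply (continuous_in_interior pr _ _ _ _ Hpr R4), locally_right_half_plane.
  - intros r t Hr. now apply (continuous_in_interior pr _ _ _ _ Hpr R5), locally_right_half_plane.
  - intros r t Hr. now apply (continuous_in_interior pr _ _ _ _ Hpr T4), locally_right_half_plane.
  - intros r t Hr. specialize (HPDE r t Hr). apply (f_equal pr) in HPDE.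
    assert (Hadd : forall x y : C, pr (x + y)%C = pr x + pr y)
      by exact (linear_plus (U := C_R_NormedModule) (V := R_NormedModule) pr Hpr).
    assert (Hopp : forall x : C, pr (- x)%C = - pr x)
      by exact (fun x => linear_opp (U := C_R_NormedModule) (V := R_NormedModule) pr x Hpr).
    unfold Cminus in HPDE. rewrite !Hadd, Hopp, Hmul, Hpr0 in HPDE. lra.
  - intros t. now rewrite H0.
  - intros t. now rewrite H1.
  - intros t.
    (* The boundary line lies entirely in the closed half-plane, so [wt 0 t] is an ordinary
       derivative of the zero function [w 0]. *)
    assert (Hd : is_derive (fun x => pr (w 0 x)) t (pr (wt 0 t))).
    { apply (is_derive_of_within _ (fun _ => 0 <= 0) _ _ pr Hpr); [apply Hall; lra|].
      apply W2. simpl; lra. }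
    rewrite <- (is_derive_unique _ _ _ Hd).
    rewrite (Derive_ext _ (fun _ => 0)) by (intros; now rewrite H0).
    apply Derive_const.
Qed.

Theorem theorem1 :
  (forall rho : R, 0 < rho ->
     forall eps : R, 0 < eps ->
     exists N : nat, forall n : nat, (N <= n)%nat ->
     forall r t : R, - rho <= r <= rho ->
       Cmod (vim n r t - kg_series r t)%C < eps) /\
  kg_solution kg_series /\
  (forall v : R -> R -> C, kg_solution v ->
     forall r t : R, 0 <= r -> v r t = kg_series r t).
Proof.
  split; [|split].
  - intros rho Hrho eps Heps. now apply vim_unif_cv.
  - apply kg_series_solution.
  - intros v (vr & vt & vrr & vrt & vtr & vtt & V1 & V2 & V3 & V4 & V5 & V6) r t Hr.
    destruct kg_series_solution as (ur & ut & urr & urt & utr & utt & U1 & U2 & U3 & U4 & U5 & U6).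
    (* By linearity the difference of the two solutions solves the problem with zero data; its real
       and imaginary parts are treated separately. *)
    assert (Hnull : forall pr : C -> R, is_linear (pr : C_R_NormedModule -> R_NormedModule) ->
              (forall x z, pr (RtoC x * z)%C = x * pr z) -> pr (v r t - kg_series r t)%C = 0).
    { intros pr Hpr Hmul.
      apply (kg_null pr _ _ _ _ _ _ _ Hpr Hmul (C1_in_minus _ _ _ _ _ _ _ V1 U1)
               (C1_in_minus _ _ _ _ _ _ _ V2 U2) (C1_in_minus _ _ _ _ _ _ _ V3 U3)); [| | |exact Hr].
      - intros x y Hx.
        transitivity ((vrr x y - vtt x y + RtoC x * v x y)
                      - (urr x y - utt x y + RtoC x * kg_series x y))%C; [ring|].
        rewrite V4, U4 by exact Hx. ring.
      - intros y. rewrite V5, U5. ring.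
      - intros y. rewrite V6, U6. ring. }
    pose proof (Hnull Re (is_linear_fst (U := R_NormedModule) (V := R_NormedModule))) as HRe.
    pose proof (Hnull Im (is_linear_snd (U := R_NormedModule) (V := R_NormedModule))) as HIm.
    specialize (HRe ltac:(intros; unfold Re, Im; simpl; ring)). specialize (HIm ltac:(intros; unfold Re, Im; simpl; ring)).
    change (fst (v r t) + - fst (kg_series r t) = 0) in HRe.
    change (snd (v r t) + - snd (kg_series r t) = 0) in HIm.
    apply injective_projections; lra.
Qed.
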